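(* Let $L>0$, $0\le\mu<L$, $d\ge 1$ and $p\ge 1$. Let $\mathcal{F}$ be the family of all convex $L$-smooth functions $f:\mathbb{R}^d\to\mathbb{R}$ that are $\mu$-strongly convex (when $\mu=0$: all convex $L$-smooth functions possessing a minimizer), and suppose that the smoothness and strong convexity parameters are known, i.e. the side-information is $I(f)=\{L,\mu\}$ for every $f\in\mathcal{F}$. Then the iteration complexity $\mathcal{IC}(\epsilon)$ of any oblivious, possibly stochastic, first-order $p$-CLI optimization algorithm over the class $\mathcal{C}=(\mathcal{F},I)$ is bounded from below by $$\tilde{\Omega}\left(\sqrt{\kappa}\,\ln(1/\epsilon)\right)\ \text{ if }\mu>0,\qquad \Omega\left(\sqrt{L/\epsilon}\right)\ \text{ if }\mu=0,$$ where $\kappa:=L/\mu$. The bounds hold independently of the dimension $d$ and of $p$.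
   Context: **Smoothness and strong convexity.** $f$ is $L$-smooth if $\|\nabla f(x)-\nabla f(y)\|\le L\|x-y\|$ for all $x,y$. It is $\mu$-strongly convex ($\mu>0$) if $f(y)\ge f(x)+\langle y-x,\nabla f(x)\rangle+\frac{\mu}{2}\|y-x\|^2$ for all $x,y$. **Class of optimization problems.** A pair $\mathcal{C}=(\mathcal{F},I)$, where $\mathcal{F}$ is a family of functions on a common domain $\mathrm{dom}(\mathcal{C})$ (here $\mathbb{R}^d$) and $I$ maps each $f\in\mathcal{F}$ to a side-information element. **First-order $p$-CLI.** An algorithm which, given $f\in\mathcal{F}$ and arbitrary initialization points $x^{(0)}_1,\dots,x^{(0)}_p\in\mathrm{dom}(\mathcal{C})$, generates points satisfying, for $i=1,\dots,p$ and $k=0,1,\dots$, $$x^{(k+1)}_i\in\sum_{j=1}^p\left(A^{(k)}_{ij}\,\partial f+B^{(k)}_{ij}\right)(x^{(k)}_j),$$ where the coefficients $A^{(k)}_{ij},B^{(k)}_{ij}$ are linear operators on $\mathbb{R}^d$ ($d\times d$ matrices) and $\partial f$ is the subdifferential (here $\partial f(x)=\{\nabla f(x)\}$). Here $(A\,\partial f+B)(x)$ means $A\,\partial f(x)+Bx$. It is *oblivious* if the coefficients depend only on $k$ and on the side-information $I(f)$, and not otherwise on $f$. It is *stochastic* if the points are random and the relation above holds for expectations: $\mathbb{E}x^{(k+1)}_i\in\sum_{j}(A^{(k)}_{ij}\partial f+B^{(k)}_{ij})(\mathbb{E}x^{(k)}_j)$. The point returned after $k$ iterations is $x^{(k)}_p$.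 **Iteration complexity.** $\mathcal{IC}(\epsilon)$ is the minimal $K$ such that $f(\mathbb{E}x^{(k)}_p)-\min_x f(x)<\epsilon$ for all $k\ge K$, uniformly over $f\in\mathcal{F}$ ($+\infty$ if there is no such $K$). The dependence on initialization is suppressed in the bound: one fixes $R>0$ and takes the uniformity over all $f\in\mathcal{F}$ and all initialization points that lie within distance $R$ of some common minimizer of $f$. **Asymptotic notation.** Tilde hides logarithmic factors in $L$, $\mu$ and $R$. Explicitly: for $\mu>0$ there is a universal constant $c>0$ such that, for $\kappa\ge 2$ and all sufficiently small $\epsilon>0$ (depending on $L,\mu,R$), $\mathcal{IC}(\epsilon)\ge c\sqrt{\kappa}\ln(1/\epsilon)$. For $\mu=0$ there is $c>0$ depending only on $R$ such that, for all sufficiently small $\epsilon>0$ (depending on $L,R$), $\mathcal{IC}(\epsilon)\ge c\sqrt{L/\epsilon}$. *)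

(* Defs.v *)
(* R^d is 'cV[R]_d, so that linear operators act as A *m x. *)
From HB Require Import structures.
From mathcomp Require Import all_boot all_order all_algebra.
From mathcomp Require Import all_classical all_reals all_analysis.
Import Order.TTheory GRing.Theory Num.Theory.
Import numFieldNormedType.Exports.

Set Implicit Arguments.
Unset Strict Implicit.
Unset Printing Implicit Defensive.

Local Open Scope classical_set_scope.
Local Open Scope ring_scope.

Section Functions.
Context {R : realType} {d : nat}.
Implicit Types (x y g : 'cV[R]_d) (f : 'cV[R]_d -> R).

Definition dotv x y : R := \sum_i x i 0 * y i 0.

(* The library's norm `|x| on 'cV[R]_d is the max norm, hence a separate
   Euclidean norm.  The two induce the same topology, so [differentiable] and
   ['D_v f x] have their usual meaning. *)
Definition enorm x : R := Num.sqrt (dotv x x).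

Definition grad f x : 'cV[R]_d := \col_i 'D_(delta_mx i 0) f x.

Definition subdifferential f x : set 'cV[R]_d :=
  [set g | forall y, f x + dotv (y - x) g <= f y].

Definition L_smooth (L : R) f : Prop :=
  (forall x, differentiable f x) /\
  forall x y, enorm (grad f x - grad f y) <= L * enorm (x - y).

Definition strongly_convex (mu : R) f : Prop :=
  forall x y,
    f x + dotv (y - x) (grad f x) + mu / 2 * enorm (y - x) ^+ 2 <= f y.

Definition minimizer f x : Prop := forall y, f x <= f y.

End Functions.

(* Only the values of [info] on [fun_family] are meaningful. *)
Record opt_class (R : realType) (d : nat) := OptClass {
  side_info : Type;
  fun_family : set ('cV[R]_d -> R);
  info : ('cV[R]_d -> R) -> side_info
}.

Definition smooth_family {R : realType} {d : nat} (L mu : R) :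
    set ('cV[R]_d -> R) :=
  [set f | [/\ convex_function setT f,
               L_smooth L f,
               0 < mu -> strongly_convex mu f &
               mu = 0 -> exists x, minimizer f x]].

Definition smooth_class {R : realType} (d : nat) (L mu : R) : opt_class R d :=
  {| side_info := (R * R)%type;
     fun_family := smooth_family L mu;
     info := fun=> (L, mu) |}.

Section RandomVectors.
Context {R : realType} {d : nat} {dT : measure_display} {T : measurableType dT}.
Variable P : probability T R.
Implicit Types X : T -> 'cV[R]_d.

Definition integrable_vec X : Prop :=
  forall i, P.-integrable setT (fun w => (X w i ord0)%:E).

Definition expect_vec X : 'cV[R]_d := \col_i fine ('E_P[fun w => X w i ord0])%E.

End RandomVectors.

(* The set \sum_j (A_j \partial f + B_j)(x_j), a Minkowski sum over j. *)
Definition cli_image {R : realType} {d p : nat} (f : 'cV[R]_d -> R)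
    (A B : 'I_p -> 'M[R]_d) (x : 'I_p -> 'cV[R]_d) : set 'cV[R]_d :=
  [set \sum_j (A j *m g j + B j *m x j) |
    g in [set g : 'I_p -> 'cV[R]_d | forall j, subdifferential f (x j) (g j)]].

(* A stochastic first-order p-CLI over [C], with randomness drawn from
   (T, P); a deterministic one is the special case of points that are constant
   in w : T.  The coefficients may a priori depend on the function and on the
   initialization points [x0]; see [oblivious]. *)
Record pCLI {R : realType} {d : nat} (C : opt_class R d) (p : nat)
    {dT : measure_display} {T : measurableType dT} (P : probability T R) := PCLI {
  coefA : ('cV[R]_d -> R) -> ('I_p -> 'cV[R]_d) ->
          nat -> 'I_p -> 'I_p -> 'M[R]_d;
  coefB : ('cV[R]_d -> R) -> ('I_p -> 'cV[R]_d) ->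
          nat -> 'I_p -> 'I_p -> 'M[R]_d;
  cli_point : ('cV[R]_d -> R) -> ('I_p -> 'cV[R]_d) ->
          nat -> 'I_p -> T -> 'cV[R]_d;
  point_init : forall f, fun_family C f -> forall x0 i w, cli_point f x0 0 i w = x0 i;
  point_integrable : forall f, fun_family C f -> forall x0 k i,
    integrable_vec P (cli_point f x0 k i);
  point_step : forall f, fun_family C f -> forall x0 k i,
    cli_image f (coefA f x0 k i) (coefB f x0 k i)
      (fun j => expect_vec P (cli_point f x0 k j))
      (expect_vec P (cli_point f x0 k.+1 i))
}.

Definition oblivious {R : realType} {d : nat} {C : opt_class R d} {p : nat}
    {dT : measure_display} {T : measurableType dT} {P : probability T R}
    (alg : pCLI C p P) : Prop :=
  exists A B : side_info C -> nat -> 'I_p -> 'I_p -> 'M[R]_d,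
    forall f, fun_family C f -> forall x0 k,
      coefA alg f x0 k = A (info C f) k /\ coefB alg f x0 k = B (info C f) k.

(* The least K, or +oo if there is none.  The p.+1 points are indexed from 0,
   the returned one being the last, [ord_max]. *)
Definition iteration_complexity {R : realType} {d : nat} {C : opt_class R d}
    {p : nat} {dT : measure_display} {T : measurableType dT}
    {P : probability T R} (alg : pCLI C p.+1 P) (rad eps : R) : \bar R :=
  ereal_inf [set (K%:R : R)%:E | K in [set K : nat |
    forall k, (K <= k)%N ->
    forall f, fun_family C f ->
    forall x0 xs, minimizer f xs -> (forall i, enorm (x0 i - xs) <= rad) ->
      f (expect_vec P (cli_point alg f x0 k ord_max)) - f xs < eps]].

(* Main.v *)
(* Run the algorithm from the origin on f(x) = eta/2 |x - c|^2 with |c| = rad.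
   Obliviousness makes the expected k-th iterate a vector of polynomials in eta
   of degree at most k, vanishing at eta = 0; hence the error along c is
   rad * q(eta) with q(0) = 1 and deg q <= k.  Comparing q with the Chebyshev
   polynomial W_k of the fourth kind by counting roots, some
   eta = mu + (L - mu) s^2 with 0 < s <= 1 satisfies
   |q(eta)| >= 1 / (s W_k((L + mu) / (L - mu))).  The factor 1/s gives
   eta q(eta)^2 >= L / (2k + 1)^2 when mu = 0, since W_k(1) = 2k + 1; when
   mu > 0, W_k((L + mu) / (L - mu)) is O(r^k) with
   r = (sqrt kappa + 1) / (sqrt kappa - 1). *)
Require Import Defs.
From HB Require Import structures.
From mathcomp Require Import all_boot all_order all_algebra.
From mathcomp Require Import all_classical all_reals all_analysis.
From mathcomp Require Import zify ring lra.
Import Order.TTheory GRing.Theory Num.Theory.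
Import numFieldNormedType.Exports.

Local Open Scope classical_set_scope.
Local Open Scope ring_scope.

(* Chebyshev polynomials of the fourth kind, over an arbitrary ring so that [x]
   may itself be a polynomial. *)
Fixpoint chebW {A : pzRingType} (n : nat) (x : A) : A :=
  if n is m.+1 then
    if m is l.+1 then 2 * x * chebW m x - chebW l x else 2 * x + 1
  else 1.

Lemma chebWS (A : pzRingType) n (x : A) :
  chebW n.+2 x = 2 * x * chebW n.+1 x - chebW n x.
Proof. by []. Qed.

Lemma two_step_ind (Q : nat -> Prop) :
  Q 0%N -> Q 1%N -> (forall n, Q n -> Q n.+1 -> Q n.+2) -> forall n, Q n.
Proof.
move=> Q0 Q1 QS n; suff [] : Q n /\ Q n.+1 by [].
by elim: n => [|n [Qn QSn]]; split=> //; apply: QS.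
Qed.

Lemma horner_chebW (A : comNzRingType) n (P : {poly A}) e :
  (chebW n P).[e] = chebW n P.[e].
Proof.
have H2 : (2 : {poly A}) = 2%:P by rewrite polyC_natr.
elim/two_step_ind: n => [||n IH IHS].
- by rewrite hornerC.
- by rewrite /= H2 hornerD hornerCM hornerC.
- by rewrite !chebWS hornerD hornerN H2 -!mulrA !hornerCM hornerM IH IHS.
Qed.

Lemma size_chebW (A : idomainType) n (P : {poly A}) :
  (size P <= 2)%N -> (size (chebW n P) <= n.+1)%N.
Proof.
move=> sP.
have s2P : (size (2 * P)%R <= 2)%N.
  by apply: leq_trans sP; rewrite -polyC_natr mul_polyC size_scale_leq.
elim/two_step_ind: n => [||n IH IHS].
- by rewrite size_poly1.
- by rewrite (leq_trans (size_polyD _ _)) // geq_max s2P size_poly1.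
rewrite chebWS (leq_trans (size_polyD _ _)) // geq_max size_polyN.
apply/andP; split; last by rewrite (leq_trans IH) // -addn2 leq_addr.
apply: leq_trans (size_polyMleq _ _) _.
by have := leq_sub2r 1 (leq_add s2P IHS); rewrite !subn1 => /leq_trans ->.
Qed.

(** * Closed forms and extremal property of the Chebyshev polynomials over the reals *)

Section Chebyshev.
Context {R : realType}.

Lemma chebW1 n : chebW n (1 : R) = n.*2.+1%:R.
Proof.
elim/two_step_ind: n => [||n IH IHS] /=; first by [].
  by rewrite mulr1 natr1.
by rewrite -/(chebW n.+1 1) IH IHS !doubleS -!natr1 mulr1; ring.
Qed.

(** At [(r + r^-1) / 2] the recurrence has characteristic roots [r] and [r^-1]. This controls the
    growth outside [-1, 1], needed when [mu > 0]. *)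
Lemma chebW_joukowski n (r : R) : r != 0 ->
  (r - 1) * chebW n ((r + r^-1) / 2) = r ^+ n.+1 - r^-1 ^+ n.
Proof.
move=> r0; elim/two_step_ind: n => [||n IH IHS].
- by rewrite expr0 mulr1 expr1.
- by rewrite /= expr1; field.
rewrite chebWS mulrBr mulrCA IHS IH !exprS !exprVn.
by field; rewrite expf_neq0 ?r0.
Qed.

(** The recurrence turns into sin(a + 2 phi) + sin(a - 2 phi) = 2 cos(2 phi) sin a. The factor
    [sin phi] is the source of the factor [s] in the extremal bound. *)
Lemma chebW_sin n (phi : R) :
  chebW n (cos (phi *+ 2)) * sin phi = sin (phi *+ n.*2.+1).
Proof.
elim/two_step_ind: n => [||n IH IHS].
- by rewrite mul1r.
- by rewrite /= (mulrSr phi 2) sinD cos_mulr2n sin_mulr2n; ring.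
rewrite chebWS mulrBl -mulrA IH IHS !doubleS.
set a := phi *+ n.*2.+3.
have -> : phi *+ n.*2.+1 = a - phi *+ 2 by rewrite -mulrnBr.
have -> : phi *+ n.*2.+3.+2 = a + phi *+ 2 by rewrite -mulrnDr addn2.
by rewrite (sinB a) (sinD a); ring.
Qed.

(** The intermediate value theorem gives a root strictly inside each gap; the one from the last gap
    exceeds [t n], so it differs from those given by induction. *)
Lemma alternating_roots (p : {poly R}) (t : nat -> R) n :
  (forall j, (j < n)%N -> t j < t j.+1) ->
  (forall j, (j <= n)%N -> 0 < (-1) ^+ j * p.[t j]) ->
  exists rs : seq R, [/\ size rs = n, uniq rs, all (root p) rs &
    all (fun z => t 0%N < z < t n) rs].
Proof.
elim: n => [|n IH] tS alt; first by exists [::].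
have [|j jn|rs [srs urs rrs brs]] := IH; first by move=> j jn; apply: tS; lia.
  by apply: alt; lia.
have t0n : t 0%N <= t n.
  have : forall m, (m <= n)%N -> t 0%N <= t m.
    elim=> // m IHm mn; apply: le_trans (ltW (tS m _)); first by apply: IHm; lia.
    lia.
  exact.
have tn := tS n (ltnSn n).
have [z zin rz] : exists2 z, t n < z < t n.+1 & root p z.
  have /= A0 := alt n (leqnSn n); have /= A1 := alt n.+1 (leqnn _).
  (* The sign makes [P] negative at [t n] and positive at [t n.+1], as [poly_ivt] requires. *)
  pose P := (- (-1) ^+ n) *: p.
  have [z zin] : exists2 z, z \in `[t n, t n.+1] & root P z.
    apply: poly_ivt; first exact: ltW.
    rewrite /P !hornerZ !mulNr; move: A1; rewrite exprS mulN1r mulNr.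
    by lra.
  rewrite /P rootZ ?oppr_eq0 ?signr_eq0 // => rz.
  exists z => //; move: zin; rewrite in_itv /= !le_eqVlt.
  move=> /andP[/orP[/eqP e|->] /orP[/eqP e'|->]] //.
  - by move: tn; rewrite e -e' ltxx.
  - by move: A0; rewrite e (rootP rz) mulr0 !ltxx.
  - by move: A1; rewrite -e' (rootP rz) mulr0 !ltxx.
exists (z :: rs); split=> //=.
- by rewrite srs.
- rewrite urs andbT; apply/negP => /(allP brs) /andP[_ ztn].
  by move: zin => /andP[/(lt_trans ztn)]; rewrite ltxx.
- by rewrite rz.
- case/andP: zin => z1 ->; rewrite (le_lt_trans t0n z1) /=.
  by apply: sub_all brs => y /andP[-> /lt_trans ->].
Qed.

(* Otherwise W/W(x0) - q, with W of degree n, would have n roots in ]mu, L[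
   between the alternation points, and one more at 0. *)
Lemma chebW_extremal (L mu : R) n (q : {poly R}) :
  0 <= mu -> mu < L -> (size q <= n.+1)%N -> q.[0] = 1 ->
  exists2 s : R, 0 < s <= 1 &
    1 <= chebW n ((L + mu) / (L - mu)) * s * `|q.[mu + (L - mu) * s ^+ 2]|.
Proof.
move=> mu0 muL sq q0.
set W0 := chebW n _; apply: contrapT => /forall2NP H.
(* Chosen so that (2n + 1) phi_j = pi/2 + j pi has sine (-1)^j. For j <= n, 2 phi_j stays in ]0,
   pi], where cosine decreases, so [t] increases, up to [t n = L]. *)
pose phi j : R := (pi / 2 / n.*2.+1%:R) *+ j.*2.+1.
pose t j : R := mu + (L - mu) * sin (phi j) ^+ 2.
have Lmu : 0 < L - mu by rewrite subr_gt0.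
have N0 : (0 : R) < n.*2.+1%:R by rewrite ltr0n.
have phi2E j : phi j *+ 2 = pi / n.*2.+1%:R * j.*2.+1%:R.
  rewrite /phi -mulrnA -[LHS]mulr_natr natrM; field.
  by rewrite gt_eqF.
have phi2_bound j : (j <= n)%N -> 0 < phi j *+ 2 <= pi.
  move=> jn; rewrite phi2E mulr_gt0 ?divr_gt0 ?pi_gt0 ?ltr0n //=.
  rewrite -mulrA ler_piMr ?pi_ge0 // ler_pdivrMl // mulr1 ler_nat; lia.
have sin_gt0 j : (j <= n)%N -> 0 < sin (phi j).
  move=> jn; apply: sin_gt0_pi; have := phi2_bound j jn; have := pi_gt0 R.
  by rewrite mulr2n; lra.
have sin_le1 j : sin (phi j) <= 1 by rewrite sin_le1.
have sin2 j : sin (phi j) ^+ 2 = (1 - cos (phi j *+ 2)) / 2.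
  by rewrite cos_mulr2n sin2cos2; field.
have tS j : (j < n)%N -> t j < t j.+1.
  move=> jn; rewrite /t ltrD2l ltr_pM2l // !sin2 ltr_pM2r // ltrD2l ltrN2.
  have /andP[a1 b1] := phi2_bound j (ltnW jn).
  have /andP[a2 b2] := phi2_bound j.+1 jn.
  rewrite ltr_cos ?in_itv /= ?(ltW a1) ?(ltW a2) //.
  by rewrite !phi2E ltr_pM2l ?divr_gt0 ?pi_gt0 // ltr_nat; lia.
(* Sends [mu] to 1, [L] to -1, [t j] to cos(2 phi_j), and 0 to the argument of [W0]. *)
pose aff : {poly R} := ((L + mu) / (L - mu))%:P - (2 / (L - mu)) *: 'X.
have affE e : aff.[e] = (L + mu - 2 * e) / (L - mu).
  by rewrite /aff !hornerE; field; rewrite gt_eqF.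
have saff : (size aff <= 2)%N.
  rewrite (leq_trans (size_polyD _ _)) // geq_max size_polyN.
  rewrite (leq_trans (size_polyC_leq1 _)) //.
  by rewrite (leq_trans (size_scale_leq _ _)) // size_polyX.
pose p := chebW n aff - W0 *: q.
have Wt j : (j <= n)%N -> (chebW n aff).[t j] * sin (phi j) = (-1) ^+ j.
  move=> jn; rewrite horner_chebW affE.
  have -> : (L + mu - 2 * t j) / (L - mu) = cos (phi j *+ 2).
    by rewrite /t sin2; field; rewrite gt_eqF.
  rewrite chebW_sin.
  have -> : phi j *+ n.*2.+1 = pi / 2 + pi *+ j.
    rewrite -[LHS]mulr_natr /phi -[_ *+ j.*2.+1]mulr_natr -[pi *+ j]mulr_natr.
    rewrite -[j.*2.+1%:R]natr1 -(mul2n j) natrM; field.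
    by rewrite gt_eqF.
  elim: (j) => [|i IHi]; first by rewrite mulr0n addr0 sin_pihalf expr0.
  by rewrite (mulrSr pi i) addrA sinDpi IHi exprS mulN1r.
(* At an argument at least 1 the values start at 1 and are nondecreasing in the degree; the
   induction carries both facts. *)
have W0_ge0 : 0 <= W0.
  have x1 : 1 <= (L + mu) / (L - mu) by rewrite ler_pdivlMr // mul1r; lra.
  suff [] : 1 <= W0 /\ W0 <= chebW n.+1 ((L + mu) / (L - mu)) by lra.
  rewrite /W0; elim: (n) => [|m [IH1 IH2]]; first by rewrite /=; lra.
  split; first exact: le_trans IH2.
  rewrite chebWS; nra.
(* After multiplication by [sin (phi j)] the first term of [p] is (-1)^j, and the negated conclusion
   at [s = sin (phi j)] makes the second smaller than 1 in absolute value. *)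
have alt j : (j <= n)%N -> 0 < (-1) ^+ j * p.[t j].
  move=> jn; have s0 := sin_gt0 j jn.
  have [/negP|/negP] := H (sin (phi j)); first by rewrite s0 sin_le1.
  rewrite -ltNge -/(t j) => Hj.
  rewrite -(pmulr_lgt0 _ s0) /p hornerD hornerN hornerZ.
  rewrite -mulrA mulrBl Wt // mulrBr -expr2 sqrr_sign subr_gt0.
  apply: le_lt_trans Hj; rewrite (le_trans (ler_norm _)) //.
  rewrite !normrM normrX normrN1 expr1n mul1r (ger0_norm W0_ge0).
  by rewrite (gtr0_norm s0) mulrAC.
have p_neq0 : p != 0.
  by apply/eqP => p0; have := alt 0%N (leq0n n); rewrite p0 horner0 mulr0 !ltxx.
have sp : (size p <= n.+1)%N.
  rewrite (leq_trans (size_polyD _ _)) // geq_max size_polyN size_chebW //=.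
  exact: leq_trans (size_scale_leq _ _) sq.
have r0 : root p 0.
  rewrite rootE /p hornerD hornerN hornerZ q0 horner_chebW affE.
  by rewrite mulr0 subr0 mulr1 subrr.
have [rs [srs urs rrs brs]] := alternating_roots p t n tS alt.
have t0 : 0 < t 0%N by rewrite ltr_wpDl // mulr_gt0 // exprn_gt0 // sin_gt0.
have rs0 : 0 \notin rs.
  by apply/negP => /(allP brs) /andP[/(lt_trans t0)]; rewrite ltxx.
(* Together with 0, [rs] gives n + 1 distinct roots, too many for a nonzero polynomial of size at
   most n + 1. *)
have := max_poly_roots p_neq0 (rs := 0 :: rs).
rewrite /= r0 rrs urs srs rs0 => /(_ isT isT) ltp.
by have := leq_trans ltp sp; rewrite ltnn.
Qed.

End Chebyshev.

(** * Isotropic quadratics: expansion, subgradients, membership in the class *)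

Section Quadratic.
Context {R : realType} {d : nat}.
Implicit Types (x y z c g v : 'cV[R]_d).

Lemma dotvC x y : dotv x y = dotv y x.
Proof. by apply: eq_bigr => i _; rewrite mulrC. Qed.

Lemma dotvDl x y z : dotv (x + y) z = dotv x z + dotv y z.
Proof. by rewrite -big_split; apply: eq_bigr => i _; rewrite mxE mulrDl. Qed.

Lemma dotvZl a x y : dotv (a *: x) y = a * dotv x y.
Proof. by rewrite mulr_sumr; apply: eq_bigr => i _; rewrite mxE mulrA. Qed.

Lemma dotvDr x y z : dotv x (y + z) = dotv x y + dotv x z.
Proof. by rewrite dotvC dotvDl !(dotvC x). Qed.

Lemma dotvZr a x y : dotv x (a *: y) = a * dotv x y.
Proof. by rewrite dotvC dotvZl dotvC. Qed.

Lemma dotv_delta i x : dotv (delta_mx i 0) x = x i 0.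
Proof.
rewrite /dotv (bigD1 i) //= big1 => [|j ji]; last by rewrite mxE (negbTE ji) mul0r.
by rewrite mxE !eqxx mul1r addr0.
Qed.

Lemma dotvv_ge_sqr x i : x i 0 ^+ 2 <= dotv x x.
Proof.
rewrite /dotv (bigD1 i) //= -expr2 lerDl sumr_ge0 // => j _.
by rewrite -expr2 sqr_ge0.
Qed.

Lemma dotvv_ge0 x : 0 <= dotv x x.
Proof. by apply: sumr_ge0 => j _; rewrite -expr2 sqr_ge0. Qed.

Lemma dotvv_eq0 x : dotv x x <= 0 -> x = 0.
Proof.
move=> x0; apply/matrixP => i j; rewrite (ord1 j) mxE; apply/eqP.
by rewrite -sqrf_eq0 eq_le sqr_ge0 andbT (le_trans (dotvv_ge_sqr x i)).
Qed.

Lemma enorm_sqr x : enorm x ^+ 2 = dotv x x.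
Proof. by rewrite sqr_sqrtr // dotvv_ge0. Qed.

Lemma enormZ a x : 0 <= a -> enorm (a *: x) = a * enorm x.
Proof.
move=> a0; rewrite /enorm dotvZl dotvZr mulrA -expr2 sqrtrM ?sqr_ge0 //.
by rewrite sqrtr_sqr ger0_norm.
Qed.

Definition quad (eta : R) c x : R := eta / 2 * dotv (x - c) (x - c).

(** Exact second-order Taylor expansion, from which the derivative, the subdifferential, convexity
    and strong convexity are all read off. *)
Lemma quadD eta c x v :
  quad eta c (x + v) = quad eta c x + dotv v (eta *: (x - c)) + eta / 2 * dotv v v.
Proof.
rewrite /quad addrAC !dotvDl !dotvDr dotvZr !(dotvC _ v) !dotvDr.
by field.
Qed.

Lemma quad_min eta c : 0 <= eta -> minimizer (quad eta c) c.
Proof.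
move=> eta0 z; rewrite /quad subrr -[X in dotv X](scale0r 0) dotvZl mul0r mulr0.
by rewrite mulr_ge0 ?divr_ge0 ?dotvv_ge0.
Qed.

Lemma differentiable_quad eta c x : differentiable (quad eta c) x.
Proof.
have -> : quad eta c =
    (eta / 2) *: \sum_(i < d) ((fun y : 'cV[R]_d => y i 0) - cst (c i 0)) ^+ 2.
  apply/funext => y; rewrite /quad /dotv !fctE fct_sumE; congr (_ * _).
  by apply: eq_bigr => i _; rewrite !mxE !fctE expr2.
apply: differentiableZ; apply: differentiable_sum => i; apply: differentiableX.
by apply: differentiableB; [exact: differentiable_coord|].
Qed.

Lemma derive_quad eta c x v : 'D_v (quad eta c) x = dotv v (eta *: (x - c)).
Proof.
rewrite /derive; apply/cvg_lim => //.
set a := dotv v _.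
(* The difference quotient equals [a + h * b] for every nonzero [h]. *)
pose b := eta / 2 * dotv v v.
have h1 : (fun h : R => a + h * b) @ (0 : R)^' --> a + 0 * b.
  apply: cvg_within_filter.
  by apply: cvgD; [exact: cvg_cst|apply: cvgMl; exact: cvg_id].
rewrite mul0r addr0 in h1.
apply: cvg_trans h1; apply: near_eq_cvg; near=> h.
have h0 : h != 0 by near: h; exact: nbhs_dnbhs_neq.
rewrite /= [h *: v + x]addrC quadD !dotvZl -/a dotvZr /b /GRing.scale /=.
by field.
Unshelve. all: by end_near.
Qed.

Lemma grad_quad eta c x : grad (quad eta c) x = eta *: (x - c).
Proof.
by apply/matrixP => i j; rewrite (ord1 j) mxE derive_quad dotv_delta.
Qed.

Lemma subdifferential_quad eta c x g : 0 < eta ->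
  subdifferential (quad eta c) x g -> g = eta *: (x - c).
Proof.
move=> eta0 gs; apply/eqP; rewrite -subr_eq0; apply/eqP/dotvv_eq0.
set v := g - _; have gE : g = v + eta *: (x - c) by rewrite subrK.
(* [v] is the excess of the subgradient over the gradient. This test point yields |v|^2 / eta <=
   |v|^2 / (2 eta), forcing [v = 0]. *)
have := gs (x + eta^-1 *: v).
rewrite quadD addrAC subrr add0r {1}gE dotvDr !dotvZl !dotvZr => h.
have : eta^-1 * dotv v v <= eta^-1 * dotv v v / 2.
  have -> : eta^-1 * dotv v v / 2 = eta / 2 * (eta^-1 * (eta^-1 * dotv v v)).
    by field; rewrite gt_eqF.
  by lra.
rewrite -mulrA ler_pM2l ?invr_gt0 //; lra.
Qed.

Lemma quad_convex eta c x y (t : R) : 0 <= eta -> 0 <= t <= 1 ->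
  quad eta c (t *: x + (1 - t) *: y) <= t * quad eta c x + (1 - t) * quad eta c y.
Proof.
move=> eta0 /andP[t0 t1].
have -> : t *: x + (1 - t) *: y = y + t *: (x - y).
  by rewrite scalerBl scalerBr scale1r addrC -addrA; congr (_ + _); rewrite addrC.
rewrite -{2}(subrKC y x) !quadD !dotvZl !dotvZr.
(* This is exactly the gap in the convexity inequality. *)
have : 0 <= eta / 2 * dotv (x - y) (x - y) * (t * (1 - t)).
  by rewrite !mulr_ge0 ?dotvv_ge0 ?subr_ge0 ?divr_ge0.
lra.
Qed.

Lemma quad_smooth_family (L mu eta : R) c :
  0 < eta -> mu <= eta -> eta <= L -> smooth_family L mu (quad eta c).
Proof.
move=> eta0 mueta etaL; split.
- move=> t x y _ _; apply: quad_convex; first exact: ltW.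
  by rewrite ge0 le1.
- split=> [x|x y]; first exact: differentiable_quad.
  rewrite !grad_quad -scalerBr opprB addrA addrNK enormZ ?(ltW eta0) //.
  by rewrite ler_wpM2r // sqrtr_ge0.
- move=> mu0 x y; rewrite grad_quad enorm_sqr.
  rewrite -[in leRHS](subrKC x y) quadD lerD2l ler_wpM2r ?dotvv_ge0 //.
  by rewrite ler_pM2r.
- by move=> _; exists c; apply: quad_min => //; exact: ltW.
Qed.

End Quadratic.

(** * Expected iterates as polynomials in the curvature *)

Section CLI.
Context {R : realType} {d p : nat} {dT : measure_display} {T : measurableType dT}.
Context {P : probability T R} {L mu : R}.
Context (alg : pCLI (smooth_class d L mu) p.+1 P) (obl : oblivious alg).

Lemma expect_point0 f x0 i : smooth_family L mu f ->
  expect_vec P (cli_point alg f x0 0 i) = x0 i.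
Proof.
move=> Ff; apply/matrixP => r c; rewrite (ord1 c) mxE.
have -> : (fun w => cli_point alg f x0 0 i w r ord0) = cst (x0 i r ord0).
  by apply/funext => w; rewrite (point_init alg).
by rewrite expectation_cst.
Qed.

(** The side information is always [(L, mu)], so the coefficient matrices, and hence [Q], are the
    same for all [eta]. The only dependence on [eta] enters through the gradient eta (x - c), which
    raises the degree by at most one per step. *)
Lemma expect_point_poly (c : 'cV[R]_d) k :
  exists Q : 'I_p.+1 -> 'I_d -> {poly R},
    (forall j r, (size (Q j r) <= k.+1)%N /\ (Q j r).[0] = 0) /\
    forall eta, 0 < eta -> mu <= eta -> eta <= L -> forall j r,
      expect_vec P (cli_point alg (quad eta c) (fun=> 0) k j) r 0 = (Q j r).[eta].
Proof.
have [A [B AB]] := obl.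
elim: k => [|k [Q [Q0 QE]]].
  exists (fun _ _ => 0); split=> [j r|eta eta0 mueta etaL j r].
    by rewrite size_poly0 horner0.
  by rewrite expect_point0 ?mxE ?horner0 //; exact: quad_smooth_family.
pose A' := A (L, mu) k; pose B' := B (L, mu) k.
(* The CLI recurrence read coordinatewise, with ['X] in place of [eta]. *)
exists (fun i r => \sum_j \sum_s
  (A' i j r s *: ('X * (Q j s - (c s 0)%:P)) + B' i j r s *: Q j s)).
split=> [i r|eta eta0 mueta etaL i r].
  split.
    apply: (leq_trans (size_sum _ _ _)); apply/bigmax_leqP => j _.
    apply: (leq_trans (size_sum _ _ _)); apply/bigmax_leqP => s _.
    have [sQ _] := Q0 j s.
    rewrite (leq_trans (size_polyD _ _)) // geq_max.
    rewrite !(leq_trans (size_scale_leq _ _)) ?(leq_trans sQ) //.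
    rewrite (leq_trans (size_polyMleq _ _)) // size_polyX /= ltnS.
    rewrite (leq_trans (size_polyD _ _)) // geq_max sQ size_polyN.
    by rewrite (leq_trans (size_polyC_leq1 _)).
  rewrite horner_sum big1 // => j _; rewrite horner_sum big1 // => s _.
  by have [_ Q00] := Q0 j s; rewrite hornerD !hornerZ hornerM hornerX Q00 mul0r !mulr0 addr0.
have Ff := quad_smooth_family _ _ _ c eta0 mueta etaL.
have [g gs <-] := point_step alg Ff (fun=> 0) k i.
have [-> ->] := AB _ Ff (fun=> 0) k.
rewrite summxE horner_sum; apply: eq_bigr => j _.
rewrite horner_sum !mxE -big_split; apply: eq_bigr => s _ /=.
rewrite (subdifferential_quad _ _ _ _ eta0 (gs j)).
rewrite hornerD !hornerZ hornerM hornerX hornerD hornerN hornerC -!QE //.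
by rewrite !mxE.
Qed.

(** Reduces accuracy [eps] at the single step [K] to a scalar inequality free of the algorithm, of
    [d] and of [p]; both rates are extracted from it. *)
Lemma iterate_lower_bound (rad eps : R) K :
  0 <= mu -> mu < L -> 0 < rad -> (0 < d)%N ->
  (forall f, smooth_family L mu f ->
    forall x0 xs, minimizer f xs -> (forall i, enorm (x0 i - xs) <= rad) ->
      f (expect_vec P (cli_point alg f x0 K ord_max)) - f xs < eps) ->
  exists2 s : R, 0 < s <= 1 &
    (mu + (L - mu) * s ^+ 2) * (rad ^+ 2 / 2)
      < eps * (chebW K ((L + mu) / (L - mu)) * s) ^+ 2.
Proof.
move=> mu0 muL rad0 d0 H.
pose i0 := Ordinal d0.
pose c : 'cV[R]_d := rad *: delta_mx i0 0.
have [Q [Q0 QE]] := expect_point_poly c K.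
have [sQ Q00] := Q0 ord_max i0.
(* Relative error along coordinate [i0]: the error there is - rad q(eta), and q(0) = 1 because [Q]
   vanishes at 0. *)
pose q := 1 - rad^-1 *: Q ord_max i0.
have sq : (size q <= K.+1)%N.
  rewrite (leq_trans (size_polyD _ _)) // geq_max size_poly1 size_polyN /=.
  exact: leq_trans (size_scale_leq _ _) sQ.
have q0 : q.[0] = 1 by rewrite /q !hornerE Q00 mulr0 subr0.
have [s /andP[s0 s1]] := chebW_extremal L mu K q mu0 muL sq q0.
set eta := mu + _; set W := chebW K _ => W1; clearbody W.
exists s; first by rewrite s0.
have s2 : 0 < s ^+ 2 <= 1 by rewrite exprn_gt0 // exprn_ile1 // ltW.
have eta0 : 0 < eta by rewrite ltr_wpDl // mulr_gt0 ?subr_gt0 //; case/andP: s2.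
have mueta : mu <= eta by rewrite lerDl mulr_ge0 ?subr_ge0 ?(ltW muL) // ltW //; case/andP: s2.
have etaL : eta <= L.
  by rewrite -lerBrDl ler_piMr ?subr_ge0 ?(ltW muL) //; case/andP: s2.
have Ff := quad_smooth_family _ _ _ c eta0 mueta etaL.
have dist (j : 'I_p.+1) : enorm ((0 : 'cV[R]_d) - c) <= rad.
  rewrite sub0r -scaleN1r /enorm dotvZl dotvZr mulrA mulrNN !mulr1 mul1r.
  rewrite /c dotvZl dotvZr dotv_delta mxE !eqxx mulr1 -expr2 sqrtr_sqr.
  by rewrite ger0_norm // ltW.
have := H _ Ff (fun=> 0) c (quad_min _ _ (ltW eta0)) dist.
set x := expect_vec _ _.
rewrite {2}/quad subrr -[X in dotv X](scale0r 0) dotvZl mul0r mulr0 subr0 => fx.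
have xq : (x - c) i0 0 = - rad * q.[eta].
  have xE : x i0 0 = (Q ord_max i0).[eta] by rewrite /x QE.
  rewrite mxE xE !mxE !eqxx mulr1 /q hornerD hornerN hornerZ hornerC; field.
  by rewrite gt_eqF.
(* Only coordinate [i0] of the squared error is kept. *)
have fq : eta * (rad ^+ 2 / 2) * q.[eta] ^+ 2 < eps.
  apply: le_lt_trans fx; rewrite /quad.
  have := dotvv_ge_sqr (x - c) i0; rewrite xq exprMn sqrrN => h.
  rewrite (_ : _ * q.[eta] ^+ 2 = eta / 2 * (rad ^+ 2 * q.[eta] ^+ 2)); last by field.
  by rewrite ler_wpM2l // divr_ge0 // ltW.
have Wsq : 1 <= (W * s) ^+ 2 * q.[eta] ^+ 2.
  rewrite -(real_normK (num_real q.[eta])) -exprMn; by apply: exprn_ege1.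
have Ws : 0 < (W * s) ^+ 2.
  rewrite lt_neqAle sqr_ge0 andbT eq_sym; apply/eqP => W0.
  by move: Wsq; rewrite W0 mul0r ler10.
have e0 : 0 <= eta * (rad ^+ 2 / 2).
  by rewrite mulr_ge0 ?divr_ge0 ?sqr_ge0 // ltW.
rewrite -(ltr_pM2r Ws) in fq; apply: le_lt_trans fq.
by rewrite -[leRHS]mulrA ler_peMr // [leRHS]mulrC.
Qed.

End CLI.

(** * From the scalar inequality to explicit rates *)

Section Asymptotics.
Context {R : realType}.
Implicit Types L mu rad eps : R.

(** With S = sqrt(L / eps), the last hypothesis gives rad S < 2 (2n + 1), and the smallness of [eps]
    says rad S > 4, which absorbs the additive 2 into half of rad S. *)
Lemma sqrt_rate_bound L rad eps (n : nat) : 0 < L -> 0 < rad -> 0 < eps ->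
  eps < L * rad ^+ 2 / 16 ->
  L * (rad ^+ 2 / 2) < eps * n.*2.+1%:R ^+ 2 ->
  rad / 8 * Num.sqrt (L / eps) <= n%:R.
Proof.
move=> L0 rad0 eps0 epsb H.
set S := Num.sqrt (L / eps); have S0 : 0 <= S by rewrite sqrtr_ge0.
have S2 : S ^+ 2 = L / eps by rewrite sqr_sqrtr // divr_ge0 // ltW.
have LE : L = S ^+ 2 * eps by rewrite S2 divfK // gt_eqF.
have rS0 : 0 <= rad * S by rewrite mulr_ge0 // ltW.
have h1 : (rad * S) ^+ 2 < 2 * n.*2.+1%:R ^+ 2.
  rewrite -(ltr_pM2r eps0) exprMn -mulrA -LE; lra.
have h2 : 4 ^+ 2 < (rad * S) ^+ 2.
  rewrite -(ltr_pM2r eps0) exprMn -[X in _ < X]mulrA -LE; lra.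
have h3 : 4 < rad * S by rewrite -(ltr_pXn2r (n := 2)) ?nnegrE.
have h4 : rad * S < 2 * n.*2.+1%:R.
  rewrite -(ltr_pXn2r (n := 2)) ?nnegrE ?rS0 ?mulr_ge0 // (lt_le_trans h1) //.
  by rewrite exprMn ler_wpM2r ?sqr_ge0 // expr2; lra.
move: h4; rewrite -[n.*2.+1%:R]natr1 -(mul2n n) natrM; lra.
Qed.

Definition chebyshev_rate (kappa : R) : R :=
  (Num.sqrt kappa + 1) / (Num.sqrt kappa - 1).

(** The constant C in C < eps r^(2n): since W_n <= r^(n+1) / (r - 1), multiplying the scalar
    inequality by ((r - 1) / r)^2 leaves r^(2n) on the right. *)
Definition chebyshev_const L mu rad : R :=
  mu * (rad ^+ 2 / 2) * ((chebyshev_rate (L / mu) - 1) / chebyshev_rate (L / mu)) ^+ 2.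

(** The value 4/3 is what makes S - 1 >= S / 4 for S = sqrt kappa. *)
Lemma sqrt_ge_43 (kappa : R) : 2 <= kappa -> 4 / 3 <= Num.sqrt kappa.
Proof.
move=> k2; rewrite -[leLHS]ger0_norm ?divr_ge0 // -sqrtr_sqr.
apply: ler_wsqrtr; apply: le_trans k2; rewrite expr2; lra.
Qed.

Lemma chebyshev_rate_gt1 (kappa : R) : 2 <= kappa -> 1 < chebyshev_rate kappa.
Proof.
move=> /sqrt_ge_43 k43; rewrite /chebyshev_rate ltr_pdivlMr ?mul1r; lra.
Qed.

Lemma chebyshev_const_gt0 L mu rad : 0 < mu -> 2 <= L / mu -> 0 < rad ->
  0 < chebyshev_const L mu rad.
Proof.
move=> mu0 /chebyshev_rate_gt1 k1 rad0.
have k0 := lt_trans ltr01 k1.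
by rewrite !mulr_gt0 ?exprn_gt0 ?mulr_gt0 ?invr_gt0 ?subr_gt0.
Qed.

Lemma chebyshev_rateE L mu : 0 < L -> 0 < mu -> 2 <= L / mu ->
  (L + mu) / (L - mu) = (chebyshev_rate (L / mu) + (chebyshev_rate (L / mu))^-1) / 2.
Proof.
move=> L0 mu0 k2; have k43 := sqrt_ge_43 _ k2.
rewrite /chebyshev_rate; set S := Num.sqrt _ in k43 *.
have -> : L = S ^+ 2 * mu by rewrite sqr_sqrtr ?divfK ?gt_eqF ?divr_ge0 // ltW.
have n1 : S - 1 != 0 by rewrite gt_eqF //; lra.
have n2 : S + 1 != 0 by rewrite gt_eqF //; lra.
have n3 : S ^+ 2 * mu - mu != 0.
  rewrite (_ : _ - _ = (S - 1) * (S + 1) * mu); last by ring.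
  by rewrite !mulf_neq0 // gt_eqF.
by field; rewrite n1 n2 n3.
Qed.

(** Take logarithms in C < eps r^(2n). As eps < C^2, ln C is at least half of ln eps, and ln r <= r
    - 1 = 2 / (S - 1); so (S - 1) ln(1/eps) <= 8n, and S - 1 >= S / 4 gives the constant 1/32. *)
Lemma log_rate_bound L mu rad eps s (n : nat) :
  0 < L -> 0 < mu -> 2 <= L / mu -> 0 < rad -> 0 < eps ->
  eps < chebyshev_const L mu rad ^+ 2 -> 0 < s <= 1 ->
  mu * (rad ^+ 2 / 2) < eps * (chebW n ((L + mu) / (L - mu)) * s) ^+ 2 ->
  1 / 32 * Num.sqrt (L / mu) * ln (1 / eps) <= n%:R.
Proof.
move=> L0 mu0 k2 rad0 eps0 epsC /andP[s0 s1] H.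
have C0 := chebyshev_const_gt0 _ _ _ mu0 k2 rad0.
have r1 := chebyshev_rate_gt1 _ k2; have k43 := sqrt_ge_43 _ k2.
rewrite chebyshev_rateE // in H.
move: epsC C0; rewrite /chebyshev_const.
set C := _ * (_ / _) ^+ 2 => epsC C0.
set r := chebyshev_rate _ in r1 C H epsC C0.
set W := chebW _ _ in H.
have r0 : 0 < r by exact: lt_trans r1.
have rm1 : 0 < r - 1 by rewrite subr_gt0.
have W0 : 0 <= (r - 1) * W <= r ^+ n.+1.
  rewrite chebW_joukowski ?gt_eqF // subr_ge0 gerBl exprn_ge0 ?invr_ge0 ?(ltW r0) //.
  rewrite andbT; apply: (@le_trans _ _ 1); last by rewrite exprn_ege1 // ltW.
  by rewrite exprn_ile1 ?invr_ge0 ?(ltW r0) // invf_le1 // ltW.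
have Cr : C < eps * r ^+ n.*2.
  have -> : C = mu * (rad ^+ 2 / 2) * ((r - 1) / r) ^+ 2 by [].
  rewrite -(ltr_pM2r (x := ((r - 1) / r) ^+ 2)) in H; last first.
    by rewrite exprn_gt0 // divr_gt0.
  apply: lt_le_trans H _; rewrite -mulrA ler_pM2l //.
  have -> : (W * s) ^+ 2 * ((r - 1) / r) ^+ 2 = (((r - 1) * W) * s / r) ^+ 2.
    by rewrite -exprMn; congr (_ ^+ 2); field; rewrite gt_eqF.
  rewrite -muln2 exprM; case/andP: W0 => W0 W1.
  rewrite lerXn2r ?nnegrE ?exprn_ge0 ?(ltW r0) //.
    by rewrite divr_ge0 ?(ltW r0) // mulr_ge0 // ltW.
  rewrite ler_pdivrMr // -exprSr (le_trans _ W1) //.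
  by rewrite ler_piMr.
have lnr : ln r <= r - 1.
  by rewrite -[in leLHS](subrKC 1 r) le_ln1Dx // (lt_trans _ rm1) // ltrN10.
have h1 : ln C <= ln eps + (r - 1) *+ n.*2.
  apply: le_trans (_ : _ <= ln (eps * r ^+ n.*2)) _.
    by rewrite ler_ln ?(ltW Cr) // posrE mulr_gt0 ?exprn_gt0.
  by rewrite lnM ?posrE ?exprn_gt0 // lnXn // lerD2l lerMn2r lnr orbT.
have h2 : ln eps <= ln C *+ 2.
  by rewrite -lnXn // ler_ln ?(ltW epsC) // posrE exprn_gt0.
rewrite [1 / eps]div1r lnV ?posrE //.
(* The threshold on [eps] may exceed 1; for [eps >= 1] the left side is nonpositive. *)
have [epsl|epsl] := leP 0 (ln eps).
  rewrite (le_trans _ (ler0n _ n)) // mulrN oppr_le0.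
  by rewrite !mulr_ge0 ?sqrtr_ge0.
set S := Num.sqrt _ in k43 *.
have rS : (r - 1) * (S - 1) = 2.
  by rewrite /r /chebyshev_rate -/S; field; rewrite gt_eqF //; lra.
have : - ln eps * (S - 1) <= 8 * n%:R.
  have -> : 8 * n%:R = (r - 1) *+ n.*2 * 2 * (S - 1).
    transitivity ((r - 1) * (S - 1) * (4 * n%:R)); first by rewrite rS; ring.
    by rewrite -[_ *+ n.*2]mulr_natr -(mul2n n) natrM; ring.
  rewrite ler_wpM2r //; first lra.
  move: h1 h2; rewrite mulr2n; lra.
nra.
Qed.

End Asymptotics.

Theorem theorem1 (R : realType) :
  (exists c : R, 0 < c /\
     forall L mu rad : R, 0 < L -> 0 < mu -> mu < L -> 2 <= L / mu -> 0 < rad ->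
     exists eps0 : R, 0 < eps0 /\
       forall d p : nat, (0 < d)%N ->
       forall (dT : measure_display) (T : measurableType dT)
              (P : probability T R)
              (alg : pCLI (smooth_class d L mu) p.+1 P),
         oblivious alg ->
       forall eps : R, 0 < eps -> eps < eps0 ->
         ((c * Num.sqrt (L / mu) * ln (1 / eps))%:E
            <= iteration_complexity alg rad eps)%E)
  /\
  (forall rad : R, 0 < rad ->
   exists c : R, 0 < c /\
     forall L : R, 0 < L ->
     exists eps0 : R, 0 < eps0 /\
       forall d p : nat, (0 < d)%N ->
       forall (dT : measure_display) (T : measurableType dT)
              (P : probability T R)
              (alg : pCLI (smooth_class d L 0) p.+1 P),
         oblivious alg ->
       forall eps : R, 0 < eps -> eps < eps0 ->
         ((c * Num.sqrt (L / eps))%:E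
            <= iteration_complexity alg rad eps)%E).
Proof.
split.
  exists (1 / 32); split=> [|L mu rad L0 mu0 muL k2 rad0]; first by rewrite divr_gt0.
  exists (chebyshev_const L mu rad ^+ 2).
  split; first by rewrite exprn_gt0 // chebyshev_const_gt0.
  move=> d p d0 dT T P alg obl eps eps0 epsC.
  (* Each admissible [K] is bounded below, using its accuracy guarantee only at k = K. *)
  apply: le_ereal_inf_tmp => _ [K HK <-]; rewrite lee_fin.
  have [s s01 Hs] := iterate_lower_bound alg obl rad eps K (ltW mu0) muL rad0 d0
    (HK K (leqnn K)).
  (* The curvature mu + (L - mu) s^2 is bounded below by [mu]. *)
  apply: (log_rate_bound L mu rad eps s) => //; apply: le_lt_trans Hs.
  rewrite ler_wpM2r ?divr_ge0 ?sqr_ge0 // lerDl.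
  by rewrite mulr_ge0 ?sqr_ge0 // subr_ge0 ltW.
move=> rad rad0; exists (rad / 8); split=> [|L L0]; first by rewrite divr_gt0.
exists (L * rad ^+ 2 / 16); split; first by rewrite divr_gt0 // mulr_gt0 // exprn_gt0.
move=> d p d0 dT T P alg obl eps eps0 epsC.
apply: le_ereal_inf_tmp => _ [K HK <-]; rewrite lee_fin.
have [s /andP[s0 s1]] := iterate_lower_bound alg obl rad eps K (lexx 0) L0 rad0 d0
  (HK K (leqnn K)).
(* For [mu = 0] the Chebyshev argument is 1, and s^2 cancels from both sides. *)
rewrite add0r addr0 subr0 divff ?gt_eqF // chebW1 exprMn [X in _ < X]mulrA.
rewrite mulrAC ltr_pM2r ?exprn_gt0 // => Hs.
exact: sqrt_rate_bound Hs.
Qed.
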